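(* For every graph model $\mathcal{G}$, the order theory $\mathrm{Th}_{\sqsubseteq}(\mathcal{G})$ is not recursively enumerable.
   Context: For a set $G$, $G^*$ is the set of finite subsets of $G$ and $\mathcal{P}(G)$ its powerset. A *total pair* is a pair $(G,i)$ with $G$ an infinite set (of any cardinality) and $i:G^*\times G\to G$ an injective total function. The *graph model* $\mathcal{G}$ with web $(G,i)$ is the $\lambda$-model carried by $\mathcal{P}(G)$ ordered by inclusion in which, for $\rho:\mathrm{Var}\to\mathcal{P}(G)$, untyped $\lambda$-terms are interpreted by $|x|_\rho=\rho(x)$, $|MN|_\rho=\{\alpha\in G:\exists a\subseteq|N|_\rho\text{ finite},\ i(a,\alpha)\in|M|_\rho\}$, $|\lambda x.M|_\rho=\{i(a,\alpha):a\in G^*,\ \alpha\in|M|_{\rho[x:=a]}\}$. The order theory is $\mathrm{Th}_{\sqsubseteq}(\mathcal{G})=\{(M,N):|M|_\rho\subseteq|N|_\rho\text{ for all }\rho:\mathrm{Var}\to\mathcal{P}(G)\}$. A set of pairs of $\lambda$-terms is recursively enumerable if its set of codes under a fixed effective Gödel numbering is r.e. *)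

(* Defs.v *)
From mathcomp Require Import all_boot.
From mathcomp Require Import boolp classical_sets functions cardinality.

Set Implicit Arguments.
Unset Strict Implicit.
Unset Printing Implicit Defensive.

Local Open Scope classical_set_scope.

(** * Untyped lambda-terms *)

(** Raw terms over named variables, not quotiented by alpha-conversion. *)
Inductive term : Type :=
| Var of nat
| App of term & term
| Lam of nat & term.

(** [CodeSeq.code] is the computable bijection from [seq nat] to [nat] given by
    [code [::] = 0] and [code (n :: s) = 2 ^ n * (2 * code s + 1)]. *)
Fixpoint godel (M : term) : nat :=
  match M with
  | Var x => CodeSeq.code [:: 0; x]
  | App M N => CodeSeq.code [:: 1; godel M; godel N]
  | Lam x M => CodeSeq.code [:: 2; x; godel M]
  end.

Lemma godel_inj : injective godel.
Proof.
elim=> [x|M IHM N IHN|x M IHM] [y|M' N'|y M'] /(can_inj CodeSeq.codeK) //.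
- by case=> ->.
- by case=> /IHM -> /IHN ->.
- by case=> -> /IHM ->.
Qed.

Definition godel2 (p : term * term) : nat :=
  CodeSeq.code [:: godel p.1; godel p.2].

(** * Partial recursive functions *)

(** [recfun n] is the type of programs for [n]-ary partial recursive functions
    (Kleene's schemes, with minimisation). *)
Inductive recfun : nat -> Type :=
| RZero n : recfun n
| RSucc : recfun 1
| RProj n : 'I_n -> recfun n
| RComp k n : recfun k -> ('I_k -> recfun n) -> recfun n
| RPrec n : recfun n -> recfun n.+2 -> recfun n.+1
| RMin n : recfun n.+1 -> recfun n.

(** [reval f v y]: the computation of [f] on [v] converges to [y]. Primitive
    recursion and minimisation act on the first argument:
    h(0, v) = f(v), h(m + 1, v) = g(m, h(m, v), v), and (RMin f)(v) is the
    least y with f(y, v) = 0, provided f(z, v) converges for all z < y. *)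
Fixpoint reval n (f : recfun n) : n.-tuple nat -> nat -> Prop :=
  match f in recfun n return n.-tuple nat -> nat -> Prop with
  | RZero _ => fun _ y => y = 0
  | RSucc => fun v y => y = (thead v).+1
  | RProj _ i => fun v y => y = tnth v i
  | RComp k _ f g => fun v y =>
      exists w : k.-tuple nat,
        (forall i, reval (g i) v (tnth w i)) /\ reval f w y
  | RPrec _ f g => fun v =>
      (fix rec (m : nat) : nat -> Prop :=
         if m is m'.+1 then
           fun y => exists z,
             rec m' z /\ reval g [tuple of m' :: z :: behead_tuple v] y
         else reval f (behead_tuple v)) (thead v)
  | RMin _ f => fun v y =>
      reval f [tuple of y :: v] 0 /\
      (forall z, z < y -> exists k, reval f [tuple of z :: v] k.+1)
  end.

Definition re (S : set nat) : Prop :=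
  exists f : recfun 1, forall n, S n <-> exists y, reval f [tuple n] y.

Definition re_pairs (T : set (term * term)) : Prop := re (godel2 @` T).

(** * Graph models *)

Definition finsub (G : Type) : Type := {a : set G | finite_set a}.

Record total_pair : Type := TotalPair {
  web :> Type;
  web_infinite : infinite_set [set: web];
  web_map : finsub web * web -> web;
  web_map_inj : injective web_map }.

Definition update (G : Type) (rho : nat -> set G) (x : nat) (a : set G) :
    nat -> set G :=
  fun y => if y == x then a else rho y.

Fixpoint interp (G : total_pair) (rho : nat -> set G) (M : term) : set G :=
  match M with
  | Var x => rho x
  | App M N =>
      [set alpha | exists a : finsub G,
         sval a `<=` interp rho N /\ interp rho M (web_map (a, alpha))]
  | Lam x M =>
      [set beta | exists (a : finsub G) (alpha : G),
         interp (update rho x (sval a)) M alpha /\ beta = web_map (a, alpha)]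
  end.

Definition order_theory (G : total_pair) : set (term * term) :=
  [set p | forall rho : nat -> set G, interp rho p.1 `<=` interp rho p.2].

(* Main.v *)
Require Import Defs.
From mathcomp Require Import all_boot.
From mathcomp Require Import boolp classical_sets cardinality.

Set Implicit Arguments.
Unset Strict Implicit.
Unset Printing Implicit Defensive.

Local Open Scope classical_set_scope.

(** Write [I] for [\x.x] and [K] for [\x.\y.x], and suppose that a program [f]
    enumerates the order theory of the graph model [G].

    A term [M] is built that knows its own code and runs two searches in
    parallel. The first waits for [f] to accept the pair [(M, I)]; when it
    succeeds first, [M] reduces to [K]. The second looks for a finite piece of
    some graph model in which the interpretation of [M] has an element that is
    not of the form [i(a, z)] with [z] in [a], that is, an element outside the
    interpretation of [I]; when it succeeds first, [M] reduces to [I]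
    ([diagonal_term]). No outcome is possible.
    - If the first search wins, then [M <= I] holds in [G] although [M = K] in
      every model, whereas [K <= I] fails in every graph model ([k_not_sub_id]).
    - If the second search wins, the finite piece that was found extends to a
      total model on the natural numbers without changing which of its elements
      lie in [I]. There [M] contains a point outside [I] although [M = I] in
      every model ([table_den_sub_id]).
    - If neither search succeeds, then [M <= I] fails in [G], because [f]
      accepts every pair of the theory. A point of [G] witnessing this failure
      involves only finitely many elements of [G], so some finite piece
      witnesses it too ([table_of_row]), and the second search succeeds.

    The second search is what makes the argument work for every [G]: nothing is
    known about the interpretation of a diverging term in an arbitrary graph
    model, which need not be empty, so [M] has to look for the reason why it
    could be large. Membership in a finite piece is decidable, and it is
    irrelevant whether the piece that is found has anything to do with [G].

    All programs are written in combinatory logic, so that [M] is an applicative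
    combination of the terms [K] and [S]. Their behaviour is stated as equations
    valid in every combinatory algebra; graph models and completed finite pieces
    are two instances, and no reduction theory is needed. Both are presented by
    a function [row] that decodes a point [x = i(a, y)] into the sequence
    [y :: a]; a finite piece is then a list of such sequences, the [table]. *)

(** * Combinatory algebras and bracket abstraction *)

Record calg := CAlg {
  carrier :> Type;
  capp : carrier -> carrier -> carrier;
  ck : carrier;
  cs : carrier;
  ckE : forall x y, capp (capp ck x) y = x;
  csE : forall x y z, capp (capp (capp cs x) y) z = capp (capp x z) (capp y z) }.

Inductive cl := CK | CS | CApp of cl & cl.

Fixpoint den (A : calg) (t : cl) : A :=
  match t with
  | CK => ck A
  | CS => cs A
  | CApp t u => capp (den A t) (den A u)
  end.

Arguments den : simpl never.

Lemma denA (A : calg) t u : den A (CApp t u) = capp (den A t) (den A u).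
Proof. by []. Qed.
Lemma denK (A : calg) : den A CK = ck A.
Proof. by []. Qed.
Lemma denS (A : calg) : den A CS = cs A.
Proof. by []. Qed.
Definition denE := (denA, denK, denS).

(** Combinatory terms with variables, in which programs are written before
    [abs] eliminates their variables. *)
Inductive prog := PVar of nat | PCst of cl | PApp of prog & prog.
Coercion PCst : cl >-> prog.

Declare Scope prog_scope.
Delimit Scope prog_scope with prog.
Bind Scope prog_scope with prog.
Notation "t ∙ u" := (PApp t u) (at level 40, left associativity) : prog_scope.
Declare Scope calg_scope.
Notation "x ∙ y" := (capp x y) (at level 40, left associativity) : calg_scope.

Fixpoint occurs (i : nat) (t : prog) : bool :=
  match t with
  | PVar j => i == j
  | PCst _ => false
  | PApp t u => occurs i t || occurs i u
  end.

(** The constants below are locked: unification would otherwise unfold programs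
    into trees of combinators while looking for redexes. *)
Fact cl_key : unit. Proof. by []. Qed.
Definition CI : cl := locked_with cl_key (CApp (CApp CS CK) CK).

Fixpoint unlocked_abs (i : nat) (t : prog) : prog :=
  if ~~ occurs i t then PApp CK t else
  match t with
  | PApp t u => PApp (PApp CS (unlocked_abs i t)) (unlocked_abs i u)
  | _ => CI
  end.
Definition abs := locked_with cl_key unlocked_abs.

Notation "'λ' x '@' i ',' t" := (abs i ((fun x : prog => t%prog) (PVar i)))
  (at level 200, x name, i at level 0, t at level 200) : prog_scope.

Fixpoint closed_prog (t : prog) : bool :=
  match t with
  | PVar _ => false
  | PCst _ => true
  | PApp t u => closed_prog t && closed_prog u
  end.

(** Only meant for closed programs: a variable becomes an arbitrary term. *)
Fixpoint unlocked_compile (t : prog) : cl :=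
  match t with
  | PVar _ => CK
  | PCst c => c
  | PApp t u => CApp (unlocked_compile t) (unlocked_compile u)
  end.
Definition compile := locked_with cl_key unlocked_compile.

Section Eval.
Variable A : calg.
Local Open Scope calg_scope.

Definition upd (e : nat -> A) (i : nat) (d : A) : nat -> A :=
  fun j => if j == i then d else e j.

Fixpoint eval (e : nat -> A) (t : prog) : A :=
  match t with
  | PVar i => e i
  | PCst c => den A c
  | PApp t u => eval e t ∙ eval e u
  end.

Lemma CIE (x : A) : den A CI ∙ x = x.
Proof. by rewrite /CI unlock !denE csE ckE. Qed.

Lemma eval_upd_notin e i d t : ~~ occurs i t -> eval (upd e i d) t = eval e t.
Proof.
elim: t => [j|c|t IHt u IHu] //=; last by rewrite negb_or => /andP[/IHt -> /IHu ->].
by rewrite /upd eq_sym => /negbTE ->.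
Qed.

(** The beta law of bracket abstraction. *)
Lemma absE e i t d : eval e (abs i t) ∙ d = eval (upd e i d) t.
Proof.
rewrite /abs unlock; elim: t => [j|c|t IHt u IHu] /=; last first.
- case: ifPn => [nt|_]; last by rewrite /= !denE csE IHt IHu.
  by rewrite /= denK ckE; have /= <- := eval_upd_notin e d (t := PApp t u) nt.
- by rewrite /= denK ckE.
case: ifPn => [nt|]; last by rewrite negbK /upd eq_sym => ->; exact: CIE.
by rewrite /= denK ckE /upd eq_sym (negbTE nt).
Qed.

Lemma compileE e t : closed_prog t -> den A (compile t) = eval e t.
Proof. by rewrite /compile unlock; elim: t => [i|c|t IHt u IHu] //= /andP[/IHt <- /IHu <-]. Qed.

End Eval.
Arguments upd : simpl never.

(** Half of Turing's fixed-point combinator. *)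
Definition CTuring : cl :=
  compile (λ u @ 0, λ f @ 1, f ∙ (u ∙ u ∙ f)).
Definition fixp (t : prog) : cl := compile (CTuring ∙ CTuring ∙ t).

Ltac prog_closed := by rewrite /abs ?unlock.

Lemma CTuringE (A : calg) (u f : A) :
  capp (capp (den A CTuring) u) f = capp f (capp (capp u u) f).
Proof.
by rewrite /CTuring (compileE (fun=> u)) ?absE //; prog_closed.
Qed.

(** General recursion: in [fixp (λ f @ 0, t)], the variable [f] stands for the
    function being defined. *)
Lemma fixpE (A : calg) (e : nat -> A) t : closed_prog t ->
  den A (fixp t) = capp (eval e t) (den A (fixp t)).
Proof.
by move=> ct; rewrite /fixp (compileE e) //= {1}CTuringE.
Qed.

(** [run] computes the value of a program applied to arguments; [unfold_prog]
    and [unfold_fix] first unfold a constant defined by [compile] or [fixp]. *)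
Ltac run := repeat (rewrite ?absE /= /upd /= ?denE).
Ltac unfold_compile := rewrite (compileE (fun=> ck _)); [run | prog_closed].
Ltac unfold_prog d := rewrite /d; unfold_compile.
Ltac unfold_fix d :=
  rewrite {1}/d (fixpE (fun=> ck _)); [rewrite -/d; run | prog_closed].

(** * Encoded data *)

(** Booleans, numbers and lists are encoded as their own case analysis, in the
    style of Scott. The constructors [true], [0] and [[::]] are all [CK]. A name
    [CFoo] denotes a closed program, and [CFooE] is its specification. *)
Definition CFalse : cl := compile (CK ∙ CI).
Definition bool_cl (b : bool) : cl := if b then CK else CFalse.

Definition CSucc : cl := compile (λ n @ 0, λ z @ 1, λ s @ 2, s ∙ n).
Fixpoint num (n : nat) : cl := if n is n'.+1 then CApp CSucc (num n') else CK.

Definition CCons : cl :=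
  compile (λ x @ 0, λ l @ 1, λ n @ 2, λ c @ 3, c ∙ x ∙ l).
Definition list_cl (T : Type) (enc : T -> cl) : seq T -> cl :=
  foldr (fun x l => CApp (CApp CCons (enc x)) l) CK.
Notation nums := (list_cl num).

Lemma CFalseE (A : calg) (x y : A) : capp (capp (den A CFalse) x) y = y.
Proof. by rewrite /CFalse (compileE (fun=> ck A)) //= denK ckE CIE. Qed.

Section Realizers.
Variable A : calg.
Local Open Scope calg_scope.
Implicit Types x y z : A.
Notation "⟦ c ⟧" := (den A c).

Lemma boolE b x y : ⟦bool_cl b⟧ ∙ x ∙ y = if b then x else y.
Proof. by case: b; rewrite /= ?denE ?ckE ?CFalseE. Qed.

Lemma CSuccE x y z : ⟦CSucc⟧ ∙ x ∙ y ∙ z = z ∙ x.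
Proof. by unfold_prog CSucc. Qed.

Lemma CConsE x y z t : ⟦CCons⟧ ∙ x ∙ y ∙ z ∙ t = t ∙ x ∙ y.
Proof. by unfold_prog CCons. Qed.

Definition caseE := (@ckE A, CFalseE, CSuccE, CConsE, boolE).

Lemma num_succ n : ⟦CSucc⟧ ∙ ⟦num n⟧ = ⟦num n.+1⟧.
Proof. by []. Qed.

Lemma nums_cons n s : ⟦CCons⟧ ∙ ⟦num n⟧ ∙ ⟦nums s⟧ = ⟦nums (n :: s)⟧.
Proof. by []. Qed.

(** * Programs on numbers and lists *)

Definition CDouble : cl := fixp (λ f @ 0, λ n @ 1,
  n ∙ CK ∙ (λ m @ 2, CSucc ∙ (CSucc ∙ (f ∙ m)))).

Lemma CDoubleE n : ⟦CDouble⟧ ∙ ⟦num n⟧ = ⟦num n.*2⟧.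
Proof.
elim: n => [|n IHn]; unfold_fix CDouble; first by rewrite caseE.
by rewrite caseE; run; rewrite IHn.
Qed.

Definition CShift : cl := fixp (λ f @ 0, λ n @ 1, λ m @ 2,
  n ∙ m ∙ (λ p @ 3, CDouble ∙ (f ∙ p ∙ m))).

Lemma CShiftE n m : ⟦CShift⟧ ∙ ⟦num n⟧ ∙ ⟦num m⟧ = ⟦num (2 ^ n * m)⟧.
Proof.
elim: n => [|n IHn]; unfold_fix CShift; first by rewrite caseE mul1n.
by rewrite caseE; run; rewrite IHn CDoubleE expnS -mulnA mul2n.
Qed.

(** [CCode] computes the effect of [cons] on codes of sequences. *)
Definition CCode : cl := compile (λ n @ 0, λ c @ 1,
  CShift ∙ n ∙ (CSucc ∙ (CDouble ∙ c))).

Lemma CCodeE n s :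
  ⟦CCode⟧ ∙ ⟦num n⟧ ∙ ⟦num (CodeSeq.code s)⟧ = ⟦num (CodeSeq.code (n :: s))⟧.
Proof.
unfold_prog CCode.
by rewrite CDoubleE num_succ CShiftE.
Qed.

Definition next_head (s : seq nat) : seq nat :=
  if s is n :: s' then n.+1 :: s' else [::].

(** The sequence whose code follows that of [s], so that iterating [next] from
    the empty sequence runs through all sequences of numbers. *)
Fixpoint next (s : seq nat) : seq nat :=
  match s with
  | [::] => [:: 0]
  | 0 :: s' => next_head (next s')
  | n.+1 :: s' => [:: 0, n & s']
  end.

Lemma code_next s : CodeSeq.code (next s) = (CodeSeq.code s).+1.
Proof.
elim: s => [|[|n] s IHs] //=.
- rewrite expn0 mul1n; case: (next s) IHs => [|m s'] //= E.
  by rewrite expnS -mulnA E mul2n doubleS.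
- by rewrite expn0 mul1n expnS -mulnA mul2n.
Qed.

Lemma decode_iter n : CodeSeq.decode n = iter n next [::].
Proof.
apply: (can_inj CodeSeq.codeK); rewrite CodeSeq.decodeK.
by elim: n => //= n {1}->; rewrite code_next.
Qed.

Definition CNextHead : cl := compile (λ l @ 0,
  l ∙ CK ∙ (λ x @ 1, λ r @ 2, CCons ∙ (CSucc ∙ x) ∙ r)).

Lemma CNextHeadE s : ⟦CNextHead⟧ ∙ ⟦nums s⟧ = ⟦nums (next_head s)⟧.
Proof. by case: s => [|n s]; unfold_prog CNextHead; rewrite caseE; run. Qed.

Definition CNext : cl := fixp (λ f @ 0, λ l @ 1,
  l ∙ (CCons ∙ CK ∙ CK) ∙ (λ x @ 2, λ r @ 3,
    x ∙ (CNextHead ∙ (f ∙ r)) ∙ (λ n @ 4, CCons ∙ CK ∙ (CCons ∙ n ∙ r)))).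

Lemma CNextE s : ⟦CNext⟧ ∙ ⟦nums s⟧ = ⟦nums (next s)⟧.
Proof.
elim: s => [|[|n] s IHs]; unfold_fix CNext; rewrite caseE; run => //.
- by rewrite caseE IHs CNextHeadE.
- by rewrite caseE; run.
Qed.

Definition CDecode : cl := fixp (λ f @ 0, λ n @ 1,
  n ∙ CK ∙ (λ m @ 2, CNext ∙ (f ∙ m))).

Lemma CDecodeE n : ⟦CDecode⟧ ∙ ⟦num n⟧ = ⟦nums (CodeSeq.decode n)⟧.
Proof.
rewrite decode_iter; elim: n => [|n IHn]; unfold_fix CDecode; rewrite caseE //.
by run; rewrite IHn CNextE.
Qed.

Definition CMapDecode : cl := fixp (λ f @ 0, λ l @ 1,
  l ∙ CK ∙ (λ x @ 2, λ r @ 3, CCons ∙ (CDecode ∙ x) ∙ (f ∙ r))).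

Lemma CMapDecodeE s :
  ⟦CMapDecode⟧ ∙ ⟦nums s⟧ = ⟦list_cl nums (map CodeSeq.decode s)⟧.
Proof.
elim: s => [|n s IHs]; unfold_fix CMapDecode; rewrite caseE //.
by run; rewrite CDecodeE IHs.
Qed.

Definition CEq : cl := fixp (λ f @ 0, λ n @ 1, λ m @ 2,
  n ∙ (m ∙ CK ∙ (λ p @ 3, CFalse)) ∙ (λ p @ 3, m ∙ CFalse ∙ (f ∙ p))).

Lemma CEqE n m : ⟦CEq⟧ ∙ ⟦num n⟧ ∙ ⟦num m⟧ = ⟦bool_cl (n == m)⟧.
Proof.
by elim: n m => [|n IHn] [|m]; unfold_fix CEq; rewrite caseE; run; rewrite ?caseE; run.
Qed.

Definition realizes x (p : nat -> bool) :=
  forall n, x ∙ ⟦num n⟧ = ⟦bool_cl (p n)⟧.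

Definition CAll : cl := fixp (λ f @ 0, λ p @ 1, λ l @ 2,
  l ∙ CK ∙ (λ x @ 3, λ r @ 4, p ∙ x ∙ (f ∙ p ∙ r) ∙ CFalse)).

Lemma CAllE x p s : realizes x p -> ⟦CAll⟧ ∙ x ∙ ⟦nums s⟧ = ⟦bool_cl (all p s)⟧.
Proof.
move=> xp; elim: s => [|n s IHs]; unfold_fix CAll; rewrite caseE //.
by run; rewrite xp caseE IHs; case: (p n).
Qed.

Definition CMem : cl := fixp (λ f @ 0, λ l @ 1, λ n @ 2,
  l ∙ CFalse ∙ (λ x @ 3, λ r @ 4, CEq ∙ n ∙ x ∙ CK ∙ (f ∙ r ∙ n))).

Lemma CMemE s : realizes (⟦CMem⟧ ∙ ⟦nums s⟧) [in s].
Proof.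
move=> n; elim: s => [|m s IHs]; unfold_fix CMem; rewrite caseE //.
by run; rewrite CEqE caseE IHs inE; case: (n == m).
Qed.

(** [CK] encodes the default values of both lists of numbers and tables. *)
Definition CNth : cl := fixp (λ f @ 0, λ l @ 1, λ n @ 2,
  l ∙ CK ∙ (λ x @ 3, λ r @ 4, n ∙ x ∙ (f ∙ r))).

Lemma CNthE T (enc : T -> cl) s n :
  ⟦CNth⟧ ∙ ⟦list_cl enc s⟧ ∙ ⟦num n⟧ = ⟦nth CK (map enc s) n⟧.
Proof.
elim: s n => [|x s IHs] n; unfold_fix CNth; first by rewrite caseE nth_nil.
by rewrite caseE; run; case: n => [|n] /=; rewrite ?denE caseE.
Qed.

Lemma CNth_num s n : ⟦CNth⟧ ∙ ⟦nums s⟧ ∙ ⟦num n⟧ = ⟦num (nth 0 s n)⟧.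
Proof. by rewrite CNthE; congr den; elim: s n => [|x s IHs] [|n] /=. Qed.

Lemma CNth_row T n :
  ⟦CNth⟧ ∙ ⟦list_cl nums T⟧ ∙ ⟦num n⟧ = ⟦nums (nth [::] T n)⟧.
Proof. by rewrite CNthE; congr den; elim: T n => [|x s IHs] [|n] /=. Qed.

Definition CBehead : cl := compile (λ l @ 0, l ∙ CK ∙ (λ x @ 1, λ r @ 2, r)).

Lemma CBeheadE s : ⟦CBehead⟧ ∙ ⟦nums s⟧ = ⟦nums (behead s)⟧.
Proof. by unfold_prog CBehead; case: s => [|n s]; rewrite caseE; run. Qed.

(** * Deciding membership in finite tables *)

(** The row [y :: a] at position [x] of a table says that the number [x] codes
    the pair [(a, y)]; an empty or missing row says nothing about [x]. The next
    functions decide membership in the interpretations that a table gives to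
    combinatory terms; [row_app], [row_k] and [row_s] below are the same sets in
    logical form, and explain the formulas. *)

Fixpoint has_row (p : nat -> seq nat -> bool) (j : nat) (T : seq (seq nat)) :=
  if T is e :: T' then p j e || has_row p j.+1 T' else false.

Definition CHasRow : cl := fixp (λ f @ 0, λ p @ 1, λ j @ 2, λ l @ 3,
  l ∙ CFalse ∙ (λ x @ 4, λ r @ 5, p ∙ j ∙ x ∙ CK ∙ (f ∙ p ∙ (CSucc ∙ j) ∙ r))).

Lemma CHasRowE x p j T :
  (forall n e, x ∙ ⟦num n⟧ ∙ ⟦nums e⟧ = ⟦bool_cl (p n e)⟧) ->
  ⟦CHasRow⟧ ∙ x ∙ ⟦num j⟧ ∙ ⟦list_cl nums T⟧ = ⟦bool_cl (has_row p j T)⟧.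
Proof.
move=> xp; elim: T j => [|e T IHT] j; unfold_fix CHasRow; rewrite caseE //.
by run; rewrite xp caseE num_succ (IHT j.+1); case: (p j e).
Qed.

Definition table_app (T : seq (seq nat)) (p q : nat -> bool) (y : nat) : bool :=
  has_row (fun j e => if e is x :: a then [&& x == y, p j & all q a] else false)
    0 T.

Definition CTableApp : cl := compile (λ t @ 0, λ p @ 1, λ q @ 2, λ y @ 3,
  CHasRow ∙ (λ j @ 4, λ e @ 5, e ∙ CFalse ∙ (λ x @ 6, λ a @ 7,
    CEq ∙ x ∙ y ∙ (p ∙ j ∙ (CAll ∙ q ∙ a) ∙ CFalse) ∙ CFalse)) ∙ CK ∙ t).

Lemma CTableAppE T x p y q :
  realizes x p -> realizes y q ->
  realizes (⟦CTableApp⟧ ∙ ⟦list_cl nums T⟧ ∙ x ∙ y) (table_app T p q).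
Proof.
move=> xp yq n; unfold_prog CTableApp; rewrite -denK.
apply: (CHasRowE 0) => j [|m a]; run; rewrite caseE //.
by run; rewrite CEqE caseE xp caseE (CAllE _ yq); case: eqP; case: (p j).
Qed.

Definition table_k (T : seq (seq nat)) (y : nat) : bool :=
  if nth [::] T y is x :: a then
    if nth [::] T x is z :: _ then z \in a else false
  else false.

Definition CTableK : cl := compile (λ t @ 0, λ y @ 1,
  CNth ∙ t ∙ y ∙ CFalse ∙ (λ x @ 2, λ a @ 3,
    CNth ∙ t ∙ x ∙ CFalse ∙ (λ z @ 4, λ b @ 5, CMem ∙ a ∙ z))).

Lemma CTableKE T : realizes (⟦CTableK⟧ ∙ ⟦list_cl nums T⟧) (table_k T).
Proof.
move=> n; unfold_prog CTableK; rewrite CNth_row /table_k.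
case: (nth _ _ n) => [|x a]; run; rewrite caseE //; run; rewrite CNth_row.
by case: (nth _ _ x) => [|z b]; run; rewrite caseE //; run; rewrite CMemE.
Qed.

Definition table_s (T : seq (seq nat)) (y : nat) : bool :=
  if nth [::] T y is y1 :: a then
    if nth [::] T y1 is y2 :: b then
      if nth [::] T y2 is z :: c then
        table_app T (table_app T [in a] [in c]) (table_app T [in b] [in c]) z
      else false
    else false
  else false.

Definition CTableS : cl := compile (λ t @ 0, λ y @ 1,
  CNth ∙ t ∙ y ∙ CFalse ∙ (λ y1 @ 2, λ a @ 3,
    CNth ∙ t ∙ y1 ∙ CFalse ∙ (λ y2 @ 4, λ b @ 5,
      CNth ∙ t ∙ y2 ∙ CFalse ∙ (λ z @ 6, λ c @ 7,
        CTableApp ∙ t ∙ (CTableApp ∙ t ∙ (CMem ∙ a) ∙ (CMem ∙ c))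
          ∙ (CTableApp ∙ t ∙ (CMem ∙ b) ∙ (CMem ∙ c)) ∙ z)))).

Lemma CTableSE T : realizes (⟦CTableS⟧ ∙ ⟦list_cl nums T⟧) (table_s T).
Proof.
move=> n; unfold_prog CTableS; rewrite CNth_row /table_s.
case: (nth _ _ n) => [|x a]; run; rewrite caseE //; run; rewrite CNth_row.
case: (nth _ _ x) => [|y b]; run; rewrite caseE //; run; rewrite CNth_row.
case: (nth _ _ y) => [|z c]; run; rewrite caseE //; run.
by do 2?[apply: CTableAppE]; apply: CMemE.
Qed.

Fixpoint table_den (T : seq (seq nat)) (t : cl) : nat -> bool :=
  match t with
  | CK => table_k T
  | CS => table_s T
  | CApp t u => table_app T (table_den T t) (table_den T u)
  end.

Definition table_id (T : seq (seq nat)) (y : nat) : bool :=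
  if nth [::] T y is x :: a then x \in a else false.

Definition CTableId : cl := compile (λ t @ 0, λ y @ 1,
  CNth ∙ t ∙ y ∙ CFalse ∙ (λ x @ 2, λ a @ 3, CMem ∙ a ∙ x)).

Lemma CTableIdE T : realizes (⟦CTableId⟧ ∙ ⟦list_cl nums T⟧) (table_id T).
Proof.
move=> n; unfold_prog CTableId; rewrite CNth_row /table_id.
by case: (nth _ _ n) => [|x a]; run; rewrite caseE //; run; rewrite CMemE.
Qed.

(** * Quotation and Goedel numbers *)

(** A quoted term is also encoded as its own case analysis, which makes quotation
    commute with application up to the constructor [CQuoteApp]; functions on
    quoted terms are then written by recursion on the term. *)
Definition CQuoteK : cl := compile (λ k @ 0, λ s @ 1, λ a @ 2, k).

Definition CQuoteS : cl := compile (λ k @ 0, λ s @ 1, λ a @ 2, s).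

Definition CQuoteApp : cl :=
  compile (λ p @ 0, λ q @ 1, λ k @ 2, λ s @ 3, λ a @ 4, a ∙ p ∙ q).

Lemma CQuoteKE x y z : ⟦CQuoteK⟧ ∙ x ∙ y ∙ z = x.
Proof. by unfold_prog CQuoteK. Qed.

Lemma CQuoteSE x y z : ⟦CQuoteS⟧ ∙ x ∙ y ∙ z = y.
Proof. by unfold_prog CQuoteS. Qed.

Lemma CQuoteAppE p q x y z : ⟦CQuoteApp⟧ ∙ p ∙ q ∙ x ∙ y ∙ z = z ∙ p ∙ q.
Proof. by unfold_prog CQuoteApp. Qed.

Definition quote_caseE := (CQuoteKE, CQuoteSE, CQuoteAppE).

Fixpoint quote (t : cl) : cl :=
  match t with
  | CK => CQuoteK
  | CS => CQuoteS
  | CApp t u => CApp (CApp CQuoteApp (quote t)) (quote u)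
  end.

Definition CQuote : cl := fixp (λ f @ 0, λ q @ 1,
  q ∙ quote CQuoteK ∙ quote CQuoteS ∙ (λ x @ 2, λ y @ 3,
    CQuoteApp ∙ (CQuoteApp ∙ quote CQuoteApp ∙ (f ∙ x)) ∙ (f ∙ y))).

Lemma CQuoteE t : ⟦CQuote⟧ ∙ ⟦quote t⟧ = ⟦quote (quote t)⟧.
Proof.
elim: t => [||t IHt u IHu]; unfold_fix CQuote; rewrite quote_caseE //.
by run; rewrite IHt IHu.
Qed.

Definition CTableDen : cl := fixp (λ f @ 0, λ t @ 1, λ q @ 2,
  q ∙ (CTableK ∙ t) ∙ (CTableS ∙ t) ∙ (λ x @ 3, λ y @ 4,
    CTableApp ∙ t ∙ (f ∙ t ∙ x) ∙ (f ∙ t ∙ y))).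

Lemma CTableDenE T t :
  realizes (⟦CTableDen⟧ ∙ ⟦list_cl nums T⟧ ∙ ⟦quote t⟧) (table_den T t).
Proof.
elim: t => [||t IHt u IHu] n; unfold_fix CTableDen; rewrite quote_caseE.
- exact: CTableKE.
- exact: CTableSE.
- by run; exact: CTableAppE.
Qed.

Fixpoint to_term (t : cl) : term :=
  match t with
  | CK => Lam 0 (Lam 1 (Var 0))
  | CS => Lam 0 (Lam 1 (Lam 2 (App (App (Var 0) (Var 2)) (App (Var 1) (Var 2)))))
  | CApp t u => App (to_term t) (to_term u)
  end.

(** The Goedel numbers [gk] and [gs] of the two combinators are kept abstract:
    they are far too large to be computed in unary. *)
Fixpoint cl_code (gk gs : nat) (t : cl) : nat :=
  match t with
  | CK => gk
  | CS => gs
  | CApp t u => CodeSeq.code [:: 1; cl_code gk gs t; cl_code gk gs u]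
  end.

Lemma godel_to_term t :
  godel (to_term t) = cl_code (godel (to_term CK)) (godel (to_term CS)) t.
Proof.
elim: t => [||t IHt u IHu]; [exact: erefl | exact: erefl |].
move: (godel (to_term CK)) (godel (to_term CS)) IHt IHu => gk gs IHt IHu.
by rewrite /= IHt IHu.
Qed.

Definition CGodel (gk gs : nat) : cl := fixp (λ f @ 0, λ q @ 1,
  q ∙ num gk ∙ num gs ∙ (λ x @ 2, λ y @ 3,
    CCode ∙ (CSucc ∙ CK) ∙ (CCode ∙ (f ∙ x) ∙ (CCode ∙ (f ∙ y) ∙ CK)))).

Lemma CGodelE gk gs t : ⟦CGodel gk gs⟧ ∙ ⟦quote t⟧ = ⟦num (cl_code gk gs t)⟧.
Proof.
elim: t => [||t IHt u IHu]; unfold_fix CGodel; rewrite quote_caseE //.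
run; rewrite IHt IHu -!denK num_succ.
by rewrite (CCodeE _ [::]) CCodeE (CCodeE 1).
Qed.

End Realizers.

(** * Partial recursive functions with a step bound *)

(** The result [y] is returned as [y.+1], and [0] stands for the absence of a
    result. The bound limits the searches only: everything else terminates. A
    total evaluator is needed because the search below interleaves the run of a
    program with other tests. *)
Fixpoint bounded_prec (f g : seq nat -> nat) (s : seq nat) (m : nat) : nat :=
  if m is m'.+1 then
    if bounded_prec f g s m' is z.+1 then g [:: m', z & s] else 0
  else f s.

Fixpoint bounded_min (f : nat -> nat) (u y : nat) : nat :=
  if u is u'.+1 then
    match f y with
    | 0 => 0
    | 1 => y.+1
    | _ => bounded_min f u' y.+1
    end
  else 0.

Fixpoint bounded_eval (k n : nat) (f : recfun n) : seq nat -> nat :=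
  match f with
  | RZero _ => fun s => 1
  | RSucc => fun s => (nth 0 s 0).+2
  | RProj _ i => fun s => (nth 0 s i).+1
  | RComp m _ f g => fun s =>
      let ws := [seq bounded_eval k (g i) s | i <- enum 'I_m] in
      if 0 \in ws then 0 else bounded_eval k f (map predn ws)
  | RPrec _ f g => fun s =>
      bounded_prec (bounded_eval k f) (bounded_eval k g) (behead s) (nth 0 s 0)
  | RMin _ f => fun s => bounded_min (fun y => bounded_eval k f (y :: s)) k 0
  end.

Lemma thead_nth n (v : n.+1.-tuple nat) : thead v = nth 0 v 0.
Proof. by rewrite /thead (tnth_nth 0). Qed.

Lemma bounded_min_sound f u y0 y : bounded_min f u y0 = y.+1 ->
  f y = 1 /\ forall z, y0 <= z < y -> exists k, f z = k.+2.
Proof.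
elim: u y0 => //= u IHu y0; case E: (f y0) => [|[|k]] // => [[<-]|/IHu[fy lty]].
  by split=> // z; rewrite ltnNge andbN.
split=> // z /andP[]; rewrite leq_eqVlt => /predU1P[<- _|lt_z ltzy].
  by exists k.
by apply: lty; rewrite lt_z.
Qed.

Lemma bounded_min_complete f u y0 y : y0 <= y -> y - y0 < u -> f y = 1 ->
  (forall z, y0 <= z < y -> exists k, f z = k.+2) -> bounded_min f u y0 = y.+1.
Proof.
move=> le_y0 lt_u fy lty; elim: u y0 le_y0 lt_u lty => //= u IHu y0.
rewrite leq_eqVlt => /predU1P[->|lt_y0] lt_u lty; first by rewrite fy.
have [k ->] := lty y0 (introT andP (conj (leqnn _) lt_y0)).
apply: IHu => //; first by rewrite subnS prednK ?subn_gt0.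
by move=> z /andP[lt_z ltzy]; apply: lty; rewrite ltnW.
Qed.

Lemma bounded_eval_sound k n (f : recfun n) (v : n.-tuple nat) y :
  bounded_eval k f v = y.+1 -> reval f v y.
Proof.
elim: f v y => {n} /=.
- by move=> n v y [->].
- by move=> v y [<-]; rewrite thead_nth.
- by move=> n i v y [<-]; rewrite (tnth_nth 0).
- move=> m n f IHf g IHg v y; case: ifP => // ws0 fy.
  exists [tuple (bounded_eval k (g i) v).-1 | i < m]; split=> [i|].
    rewrite tnth_mktuple; apply: IHg; rewrite prednK // lt0n.
    apply: contraFN ws0 => /eqP <-; apply: map_f; exact: mem_enum.
  by apply: IHf; rewrite -fy; congr bounded_eval; rewrite /= -map_comp enumT.
- move=> n f IHf g IHg v y; rewrite thead_nth.
  elim: (nth 0 v 0) y => [|m IHm] y /=.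
    by move=> fy; apply: IHf.
  case E: (bounded_prec _ _ _ m) => [|z] // gy; exists z; split; first exact: IHm.
  exact: IHg.
- move=> n f IHf v y /bounded_min_sound[fy lty]; split; first exact: IHf.
  by move=> z ltzy; have [j fz] := lty z ltzy; exists j; apply: IHf.
Qed.

(** Convergence for all large bounds, rather than for one, is what the induction
    needs: finitely many computations then succeed with a common bound. *)
Lemma bounded_eval_complete n (f : recfun n) (v : n.-tuple nat) y :
  reval f v y ->
  exists k0, forall k, k0 <= k -> bounded_eval k f v = y.+1.
Proof.
elim: f v y => {n} /=.
- by move=> n v y ->; exists 0.
- by move=> v y ->; exists 0 => k _; rewrite thead_nth.
- by move=> n i v y ->; exists 0 => k _; rewrite (tnth_nth 0).
- move=> m n f IHf g IHg v y [w [/(_ _)/IHg gw /IHf[k0 fy]]].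
  have [kg gE] := choice gw.
  exists (maxn k0 (\max_i kg i)) => k; rewrite geq_max => /andP[le0 leg].
  have E : [seq bounded_eval k (g i) v | i <- enum 'I_m] = map succn w.
    rewrite -[in RHS](map_tnth_enum w) -map_comp; apply: eq_map => i /=.
    by apply: gE; apply: leq_trans leg; apply: leq_bigmax.
  rewrite E; case: ifP => [/mapP[//]|_].
  by rewrite -map_comp map_id fy.
- move=> n f IHf g IHg v y; rewrite thead_nth.
  elim: (nth 0 v 0) y => [|m IHm] y /=.
    by move=> /IHf[k0 fy]; exists k0.
  case=> z [/IHm[k0 mz] /IHg[k1 gy]]; exists (maxn k0 k1) => k.
  by rewrite geq_max => /andP[/mz -> /gy].
- move=> n f IHf v y [/IHf[k0 fy] lty].
  have /choice[kz kzE] : forall z, exists kz, z < y -> exists j,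
      forall k, kz <= k -> bounded_eval k f (z :: v) = j.+2.
    move=> z; case: (ltnP z y) => [/lty[j /IHf[kz fz]]|_]; last by exists 0.
    by exists kz => _; exists j.
  exists (maxn y.+1 (maxn k0 (\max_(z < y) kz z))) => k.
  rewrite !geq_max => /and3P[lt_y le0 lez].
  apply: bounded_min_complete; rewrite ?subn0 ?fy // => z ltzy.
  have [j fz] := kzE z ltzy; exists j; apply: fz.
  by apply: leq_trans lez; apply: (leq_bigmax (Ordinal ltzy)).
Qed.

(** Evaluates a list of programs on the same arguments and passes the list of
    results to a continuation [c], unless one of them is missing. *)
Fixpoint CArgs (ts : seq cl) : cl :=
  compile (λ k @ 0, λ s @ 1, λ c @ 2,
    if ts is t :: ts' then
      t ∙ k ∙ s ∙ CK ∙ (λ y @ 3, CArgs ts' ∙ k ∙ s ∙ (λ l @ 4, c ∙ (CCons ∙ y ∙ l)))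
    else c ∙ CK).

Definition CPrec (f g : cl) : cl := fixp (λ r @ 0, λ k @ 1, λ s @ 2, λ m @ 3,
  m ∙ (f ∙ k ∙ s) ∙ (λ p @ 4, r ∙ k ∙ s ∙ p ∙ CK ∙ (λ z @ 5,
    g ∙ k ∙ (CCons ∙ p ∙ (CCons ∙ z ∙ s))))).

Definition CMin (f : cl) : cl :=
  fixp (λ r @ 0, λ k @ 1, λ s @ 2, λ u @ 3, λ y @ 4,
    u ∙ CK ∙ (λ p @ 5, f ∙ k ∙ (CCons ∙ y ∙ s) ∙ CK ∙ (λ z @ 6,
      z ∙ (CSucc ∙ y) ∙ (λ z' @ 7, r ∙ k ∙ s ∙ p ∙ (CSucc ∙ y))))).

Fixpoint CRec n (f : recfun n) : cl :=
  match f with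
  | RZero _ => compile (λ k @ 0, λ s @ 1, CSucc ∙ CK)
  | RSucc => compile (λ k @ 0, λ s @ 1, CSucc ∙ (CSucc ∙ (CNth ∙ s ∙ CK)))
  | RProj _ i => compile (λ k @ 0, λ s @ 1, CSucc ∙ (CNth ∙ s ∙ num i))
  | RComp m _ f g => compile (λ k @ 0, λ s @ 1,
      CArgs [seq CRec (g i) | i <- enum 'I_m] ∙ k ∙ s ∙ (CRec f ∙ k))
  | RPrec _ f g => compile (λ k @ 0, λ s @ 1,
      CPrec (CRec f) (CRec g) ∙ k ∙ (CBehead ∙ s) ∙ (CNth ∙ s ∙ CK))
  | RMin _ f => compile (λ k @ 0, λ s @ 1, CMin (CRec f) ∙ k ∙ s ∙ k ∙ CK)
  end.

Section RecSpecs.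
Variable A : calg.
Local Open Scope calg_scope.
Implicit Type c : A.
Notation "⟦ c ⟧" := (den A c).

Lemma CArgsE (I : Type) (r : seq I) (t : I -> cl) (h : I -> nat) k s c :
  (forall i, ⟦t i⟧ ∙ ⟦num k⟧ ∙ ⟦nums s⟧ = ⟦num (h i)⟧) ->
  ⟦CArgs (map t r)⟧ ∙ ⟦num k⟧ ∙ ⟦nums s⟧ ∙ c =
    if 0 \in map h r then ⟦CK⟧ else c ∙ ⟦nums (map predn (map h r))⟧.
Proof.
move=> tE; elim: r c => [|i r IHr] c /=; first by unfold_compile.
unfold_compile; rewrite tE inE.
case: (h i) => [|m]; rewrite caseE //; run.
by rewrite IHr /=; case: ifP => // _; run.
Qed.

Lemma CPrecE (tf tg : cl) f g k s m :
  (forall s, ⟦tf⟧ ∙ ⟦num k⟧ ∙ ⟦nums s⟧ = ⟦num (f s)⟧) ->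
  (forall s, ⟦tg⟧ ∙ ⟦num k⟧ ∙ ⟦nums s⟧ = ⟦num (g s)⟧) ->
  ⟦CPrec tf tg⟧ ∙ ⟦num k⟧ ∙ ⟦nums s⟧ ∙ ⟦num m⟧ = ⟦num (bounded_prec f g s m)⟧.
Proof.
move=> fE gE; elim: m => [|m IHm]; unfold_fix CPrec; rewrite caseE //.
run; rewrite IHm; case: (bounded_prec f g s m) => [|z]; rewrite caseE //.
by run; rewrite !nums_cons gE.
Qed.

Lemma CMinE (tf : cl) f k s u y :
  (forall y, ⟦tf⟧ ∙ ⟦num k⟧ ∙ ⟦nums (y :: s)⟧ = ⟦num (f y)⟧) ->
  ⟦CMin tf⟧ ∙ ⟦num k⟧ ∙ ⟦nums s⟧ ∙ ⟦num u⟧ ∙ ⟦num y⟧ = ⟦num (bounded_min f u y)⟧.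
Proof.
move=> fE; elim: u y => [|u IHu] y; unfold_fix CMin; rewrite caseE //.
run; rewrite nums_cons fE; case: (f y) => [|[|z]]; rewrite caseE //; run.
  by rewrite caseE.
by rewrite caseE; run; rewrite num_succ IHu.
Qed.

Lemma CRecE k n (f : recfun n) s :
  ⟦CRec f⟧ ∙ ⟦num k⟧ ∙ ⟦nums s⟧ = ⟦num (bounded_eval k f s)⟧.
Proof.
elim: f s => {n} /=.
- by move=> n s; unfold_compile.
- by move=> s; unfold_compile; rewrite -denK (CNth_num _ _ 0).
- by move=> n i s; unfold_compile; rewrite CNth_num.
- move=> m n f IHf g IHg s; unfold_compile.
  by rewrite (CArgsE _ _ (fun i => IHg i s)); case: ifP.
- move=> n f IHf g IHg s; unfold_compile.
  by rewrite CBeheadE -denK (CNth_num _ _ 0) (CPrecE _ _ IHf IHg).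
- move=> n f IHf s; unfold_compile.
  by rewrite -denK (CMinE _ 0 (fun y => IHf (y :: s))).
Qed.

End RecSpecs.

(** * A term that searches for its own properties *)

(** The second fixed-point theorem: [M] is [D] applied to its own quotation, where
    [D] rebuilds the quotation of this application before running [F]. *)
Lemma quoted_fixpoint (F : cl) :
  exists M : cl, forall A : calg, den A M = capp (den A F) (den A (quote M)).
Proof.
pose D := compile (λ x @ 0, F ∙ (CQuoteApp ∙ x ∙ (CQuote ∙ x))).
exists (CApp D (quote D)) => A.
by rewrite denA {1}/D (compileE (fun=> ck A)); [run; rewrite CQuoteE | prog_closed].
Qed.

Definition CSearch (t1 t2 : cl) : cl := fixp (λ r @ 0, λ q @ 1, λ w @ 2,
  t1 ∙ q ∙ w ∙ CK ∙ (t2 ∙ q ∙ w ∙ CI ∙ (r ∙ q ∙ (CNext ∙ w)))).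

(** The search state is a sequence of numbers: its first item bounds the run of
    [f], the second one is a candidate point, and the others are codes of the
    rows of a table. Enumerating all states tries all combinations. *)
Definition accepted (f : recfun 1) (m : nat) (w : seq nat) : bool :=
  0 < bounded_eval (nth 0 w 0) f [:: m].
Definition exceeds_id (t : cl) (w : seq nat) : bool :=
  let T := map CodeSeq.decode (behead (behead w)) in
  table_den T t (nth 0 w 1) && ~~ table_id T (nth 0 w 1).

Definition CAccepted (f : recfun 1) (gk gs gi : nat) : cl :=
  compile (λ q @ 0, λ w @ 1,
    CRec f ∙ (CNth ∙ w ∙ CK)
      ∙ (CCons ∙ (CCode ∙ (CGodel gk gs ∙ q) ∙ (CCode ∙ num gi ∙ CK)) ∙ CK)
      ∙ CFalse ∙ (λ z @ 2, CK)).

Definition CExceedsId : cl := compile (λ q @ 0, λ w @ 1,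
  (λ t @ 2, λ y @ 3, CTableDen ∙ t ∙ q ∙ y ∙ (CTableId ∙ t ∙ y ∙ CFalse ∙ CK) ∙ CFalse)
    ∙ (CMapDecode ∙ (CBehead ∙ (CBehead ∙ w))) ∙ (CNth ∙ w ∙ (CSucc ∙ CK))).

Section SearchSpecs.
Variable A : calg.
Local Open Scope calg_scope.
Implicit Type q : A.
Notation "⟦ c ⟧" := (den A c).

Lemma CSearchE (t1 t2 : cl) q (p1 p2 : seq nat -> bool) n :
  (forall w, ⟦t1⟧ ∙ q ∙ ⟦nums w⟧ = ⟦bool_cl (p1 w)⟧) ->
  (forall w, ⟦t2⟧ ∙ q ∙ ⟦nums w⟧ = ⟦bool_cl (p2 w)⟧) ->
  (forall i, i < n -> ~~ (p1 (CodeSeq.decode i) || p2 (CodeSeq.decode i))) ->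
  p1 (CodeSeq.decode n) || p2 (CodeSeq.decode n) ->
  ⟦CSearch t1 t2⟧ ∙ q ∙ ⟦CK⟧ = if p1 (CodeSeq.decode n) then ⟦CK⟧ else ⟦CI⟧.
Proof.
move=> t1E t2E before at_n.
have step w : ⟦CSearch t1 t2⟧ ∙ q ∙ ⟦nums w⟧ = if p1 w then ⟦CK⟧ else
    if p2 w then ⟦CI⟧ else ⟦CSearch t1 t2⟧ ∙ q ∙ ⟦nums (next w)⟧.
  (* Only the occurrence of the loop on the left is to be unfolded. *)
  by set rhs := RHS; unfold_fix CSearch; rewrite t1E t2E !caseE CNextE.
have reach i : i <= n -> ⟦CSearch t1 t2⟧ ∙ q ∙ ⟦CK⟧ =
    ⟦CSearch t1 t2⟧ ∙ q ∙ ⟦nums (CodeSeq.decode i)⟧.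
  elim: i => [//|i IHi] ltin; rewrite IHi 1?ltnW // step.
  have := before i ltin; rewrite negb_or => /andP[/negbTE -> /negbTE ->].
  by rewrite !decode_iter.
by rewrite (reach n) // step; case: (p1 _) at_n => //= ->.
Qed.

Lemma CAcceptedE f gk gs gi t w :
  ⟦CAccepted f gk gs gi⟧ ∙ ⟦quote t⟧ ∙ ⟦nums w⟧ =
  ⟦bool_cl (accepted f (CodeSeq.code [:: cl_code gk gs t; gi]) w)⟧.
Proof.
unfold_prog CAccepted; rewrite CGodelE -!denK (CNth_num _ w 0).
rewrite (CCodeE _ gi [::]) CCodeE (nums_cons _ _ [::]) CRecE /accepted.
by case: (bounded_eval _ _ _) => [|z]; rewrite caseE; run.
Qed.

Lemma CExceedsIdE t w :
  ⟦CExceedsId⟧ ∙ ⟦quote t⟧ ∙ ⟦nums w⟧ = ⟦bool_cl (exceeds_id t w)⟧.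
Proof.
unfold_prog CExceedsId; rewrite !CBeheadE CMapDecodeE -denK (num_succ _ 0) CNth_num.
rewrite CTableDenE CTableIdE !caseE /exceeds_id.
by case: table_den; case: table_id.
Qed.

End SearchSpecs.

Lemma accepted_sound f m w : accepted f m w -> exists y, reval f [tuple m] y.
Proof.
rewrite /accepted; case E: (bounded_eval _ _ _) => [|y] // _.
by exists y; apply: bounded_eval_sound E.
Qed.

Lemma accepted_complete f m y : reval f [tuple m] y -> exists w, accepted f m w.
Proof.
by case/bounded_eval_complete => k fk; exists [:: k]; rewrite /accepted /= fk.
Qed.

Lemma exceeds_id_complete t T y :
  table_den T t y && ~~ table_id T y -> exists w, exceeds_id t w.
Proof.
move=> ty; exists [:: 0, y & map CodeSeq.code T].
by rewrite /exceeds_id /= -map_comp (eq_map CodeSeq.codeK) map_id.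
Qed.

(** The case analysis records which test succeeds in the first state where one of
    them does. *)
Lemma diagonal_term (f : recfun 1) (gi : nat) : exists M : cl,
  let acc := accepted f (CodeSeq.code [:: godel (to_term M); gi]) in
  [\/ (exists w, acc w) /\ (forall A : calg, den A M = den A CK),
      (exists w, exceeds_id M w) /\ (forall A : calg, den A M = den A CI)
    | forall w, ~~ acc w && ~~ exceeds_id M w].
Proof.
have := godel_to_term; move: (godel (to_term CK)) (godel (to_term CS)) => gk gs gE.
have [M ME] := quoted_fixpoint (compile (λ q @ 0,
  CSearch (CAccepted f gk gs gi) CExceedsId ∙ q ∙ CK)).
exists M; rewrite gE; set acc := accepted f _ => /=.
have [found|none] := pselect (exists n,
    acc (CodeSeq.decode n) || exceeds_id M (CodeSeq.decode n)); last first.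
  apply: Or33 => w; rewrite -negb_or; apply/negP => hw; apply: none.
  by exists (CodeSeq.code w); rewrite CodeSeq.codeK.
have [n at_n n_min] := ex_minnP found.
have before i : i < n -> ~~ (acc (CodeSeq.decode i) || exceeds_id M (CodeSeq.decode i)).
  by rewrite ltnNge; apply: contra => /n_min.
have {}ME (A : calg) : den A M = if acc (CodeSeq.decode n) then den A CK else den A CI.
  rewrite ME (compileE (fun=> ck A)); last by prog_closed.
  run; rewrite -denK; apply: CSearchE before at_n => w.
  - exact: CAcceptedE.
  - exact: CExceedsIdE.
case acc_n: (acc _) in ME at_n; [apply: Or31 | apply: Or32]; split=> //.
all: by exists (CodeSeq.decode n).
Qed.

(** * Models from decoding functions *)

(** A point [x] with [row x = y :: a] codes the step function from [a] to [y]. A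
    graph model is the case where [row] inverts the map [i]; allowing a pair to
    have several codes and codes to be lists gives enough freedom to complete any
    table. Abstraction needs a code for every pair, hence [row_surj] below, while
    the beta law holds because [row] is a function. *)

Section RowModel.
Variables (X : eqType) (row : X -> seq X).
Implicit Types (d e f : set X) (x y z : X) (a b c : seq X).

Definition row_app d e : set X :=
  [set y | exists x a, [/\ row x = y :: a, d x & [set` a] `<=` e]].

(** In the notation of graph models, [K] consists of the points [i(a, i(b, z))]
    with [z] in [a], and [S] of the points [i(a, i(b, i(c, z)))] with [z] in
    [a c (b c)]. *)
Definition row_k : set X :=
  [set x | exists y a z b, [/\ row x = y :: a, row y = z :: b & z \in a]].

Definition row_s : set X :=
  [set x | exists y1 a y2 b z c,
    [/\ row x = y1 :: a, row y1 = y2 :: b, row y2 = z :: c &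
      row_app (row_app [set` a] [set` c]) (row_app [set` b] [set` c]) z]].

Fixpoint row_den (t : cl) : set X :=
  match t with
  | CK => row_k
  | CS => row_s
  | CApp t u => row_app (row_den t) (row_den u)
  end.

Lemma row_app_sub d d' e e' :
  d `<=` d' -> e `<=` e' -> row_app d e `<=` row_app d' e'.
Proof.
move=> dd' ee' y [x [a [rx dx ae]]]; exists x, a.
by split; [| exact: dd' | exact: subset_trans ee'].
Qed.

(** Application is continuous: finitely many values need only finite parts of the
    function and of its argument. *)
Lemma row_app_seq d e b : [set` b] `<=` row_app d e ->
  exists a c, [/\ [set` a] `<=` d, [set` c] `<=` e &
    [set` b] `<=` row_app [set` a] [set` c]].
Proof.
elim: b => [|y b IHb] yb; first by exists [::], [::]; split.
have [|a [c [ad ce bac]]] := IHb.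
  by move=> z zb; apply: yb; rewrite /= in_cons [z \in b]zb orbT.
have [|x [u [rx dx ue]]] := yb y; first by rewrite /= mem_head.
exists (x :: a), (c ++ u); split.
- by move=> z /=; rewrite in_cons => /predU1P[->|/ad].
- by move=> z /=; rewrite mem_cat => /orP[/ce|/ue].
move=> z /=; rewrite in_cons => /predU1P[->|/bac].
  by exists x, u; split; rewrite //= ?mem_head // => z' /=; rewrite mem_cat orbC => ->.
apply: row_app_sub => z' /=; rewrite ?in_cons ?mem_cat => ->; rewrite ?orbT //.
Qed.

Hypothesis row_surj : forall y a, exists x b, row x = y :: b /\ b =i a.

Lemma row_kE d e : row_app (row_app row_k d) e = d.
Proof.
apply/seteqP; split => [z [y [b [ry [x [a [rx [y' [a' [z' [b' [rx' ry' z'a']]]]]] ad]] be]]]|z dz].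
  by move: rx' ry'; rewrite rx => -[<- ea]; rewrite ry => -[ez _]; apply: ad; rewrite ea ez.
have [y [b [ry b0]]] := row_surj z [::].
have [x [a [rx az]]] := row_surj y [:: z].
exists y, b; split => //; last by move=> u /=; rewrite b0.
exists x, a; split => //.
  by exists y, a, z, b; split=> //; rewrite az mem_head.
by move=> u /=; rewrite az inE => /eqP ->.
Qed.

(** The finite sets [a] and [b] recorded by a point of [row_s] stand for finite
    parts of the first two arguments; by continuity the arguments themselves can
    take their place. *)
Lemma row_s2E d e : row_app (row_app row_s d) e =
  [set x | exists z c, row x = z :: c /\
    row_app (row_app d [set` c]) (row_app e [set` c]) z].
Proof.
apply/seteqP; split => x.
  case=> x1 [b [r1 [x2 [a [r2 [y1 [a' [y2 [b' [z [c [r2' r1' rx zc]]]]]]] ad]] be]]].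
  move: r2' r1' rx zc; rewrite r2 => -[<- <-].
  rewrite r1 => -[<- <-] rx zc; exists z, c.
  by split=> //; apply: row_app_sub zc; exact: row_app_sub.
case=> z [c [rx [p [u [rp dcp ecu]]]]].
have [a1 [c1 [a1d c1c pa1]]] : exists a c', [/\ [set` a] `<=` d,
    [set` c'] `<=` [set` c] & [set` [:: p]] `<=` row_app [set` a] [set` c']].
  by apply: row_app_seq => q /=; rewrite inE => /eqP ->.
have [b1 [c2 [b1e c2c ub1]]] := row_app_seq ecu.
have [x1 [b [r1 bb1]]] := row_surj x b1.
have [x2 [a [r2 aa1]]] := row_surj x1 a1.
exists x1, b; split=> //; last by move=> q /=; rewrite bb1; exact: b1e.
exists x2, a; split=> //; last by move=> q /=; rewrite aa1; exact: a1d.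
exists x1, a, x, b, z, c; split=> //; exists p, u; split=> //.
  have : row_app [set` a1] [set` c1] p by apply: pa1; rewrite /= mem_head.
  by apply: row_app_sub => // q /=; rewrite aa1.
move=> q /ub1; apply: row_app_sub => // q' /=; by rewrite bb1.
Qed.

Lemma row_sE d e f : row_app (row_app (row_app row_s d) e) f =
  row_app (row_app d f) (row_app e f).
Proof.
rewrite row_s2E; apply/seteqP; split => z.
  case=> x [c [rx [z' [c']]]]; rewrite rx => -[[<- <-]] zc cf.
  by apply: row_app_sub zc; exact: row_app_sub.
case=> p [u [rp dfp efu]].
have [a1 [c1 [a1d c1f pa1]]] : exists a c, [/\ [set` a] `<=` d,
    [set` c] `<=` f & [set` [:: p]] `<=` row_app [set` a] [set` c]].
  by apply: row_app_seq => q /=; rewrite inE => /eqP ->.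
have [b1 [c2 [b1e c2f ub1]]] := row_app_seq efu.
have [x [c [rx cc]]] := row_surj z (c1 ++ c2).
exists x, c; split=> //; last first.
  by move=> q /=; rewrite cc mem_cat => /orP[/c1f|/c2f].
exists z, c; split=> //; exists p, u; split=> //.
  have : row_app [set` a1] [set` c1] p by apply: pa1; rewrite /= mem_head.
  by apply: row_app_sub => // q /=; rewrite cc mem_cat => ->.
move=> q /ub1; apply: row_app_sub => // q' /=.
by rewrite cc mem_cat orbC => ->.
Qed.

Definition row_calg : calg := CAlg row_kE row_sE.

Lemma row_calgE t : den row_calg t = row_den t.
Proof. by elim: t => //= t <- u <-. Qed.

(** [CI] is [S K K], so that [row_s2E] reduces membership of [x] to [z] lying in
    [K c (K c) = c]. *)
Lemma row_den_id : row_den CI = [set x | exists z c, row x = z :: c /\ z \in c].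
Proof.
rewrite /CI unlock /= row_s2E; apply/seteqP.
by split=> x [z [c [rx]]] zc; exists z, c; split=> //; move: zc; rewrite row_kE.
Qed.

End RowModel.

(** Membership of a point in [row_den row t] is positive in the equations
    [row x = y :: a]: it is preserved by maps that preserve them, injective or
    not, and depends on finitely many of them. *)
Section Renaming.
Variables (X Y : eqType) (phi : X -> Y) (r : X -> seq X) (r' : Y -> seq Y).
Hypothesis phiP : forall x, r x <> [::] -> r' (phi x) = map phi (r x).

Lemma row_app_morph (d e : set X) (d' e' : set Y) :
  (forall x, d x -> d' (phi x)) -> (forall x, e x -> e' (phi x)) ->
  forall x, row_app r d e x -> row_app r' d' e' (phi x).
Proof.
move=> dd' ee' y [x [a [rx dx ae]]]; exists (phi x), (map phi a).
split; [by rewrite phiP rx | exact: dd' |].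
by move=> _ /mapP[z za ->]; apply: ee'; apply: ae.
Qed.

Lemma row_den_morph t x : row_den r t x -> row_den r' t (phi x).
Proof.
elim: t x => [||t IHt u IHu] x /=; last exact: row_app_morph.
- case=> [y [a [z [b [rx ry za]]]]].
  exists (phi y), (map phi a), (phi z), (map phi b).
  by rewrite !phiP ?rx ?ry //; split; rewrite ?map_f.
case=> [y1 [a [y2 [b [z [c [rx r1 r2 zc]]]]]]].
exists (phi y1), (map phi a), (phi y2), (map phi b), (phi z), (map phi c).
rewrite !phiP ?rx ?r1 ?r2 //; split=> //.
by move: z zc {r2}; do 2!apply: row_app_morph; move=> z; exact: map_f.
Qed.

End Renaming.

Section FiniteSupport.
Variable X : eqType.
Implicit Types r : X -> seq X.

Definition finite_support (D : (X -> seq X) -> set X) :=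
  forall r y, D r y -> exists s : seq X, forall r', {in s, r' =1 r} -> D r' y.

Lemma finite_support_app D E : finite_support D -> finite_support E ->
  finite_support (fun r => row_app r (D r) (E r)).
Proof.
move=> fD fE r y [x [a [rx /fD[s sP] ae]]].
have [s' s'P] : exists s' : seq X, forall r', {in s', r' =1 r} -> [set` a] `<=` E r'.
  elim: a {rx} ae => [|z a IHa] ae; first by exists [::].
  have [|s1 s1P] := IHa; first by move=> u ua; apply: ae; rewrite /= in_cons [u \in a]ua orbT.
  have [|s2 s2P] := fE r z; first by apply: ae; rewrite /= mem_head.
  exists (s1 ++ s2) => r' rr' u /=; rewrite in_cons => /predU1P[->|].
    by apply: s2P => v vs; apply: rr'; rewrite mem_cat vs orbT.
  by apply: s1P => v vs; apply: rr'; rewrite mem_cat vs.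
exists (x :: s ++ s') => r' rr'; exists x, a; split.
- by rewrite rr' ?mem_head.
- by apply: sP => v vs; apply: rr'; rewrite in_cons mem_cat vs orbT.
- by apply: s'P => v vs; apply: rr'; rewrite in_cons mem_cat vs !orbT.
Qed.

Lemma row_den_support t : finite_support (fun r => row_den r t).
Proof.
elim: t => [||t IHt u IHu] /=; last exact: finite_support_app.
- move=> r x [y [a [z [b [rx ry za]]]]]; exists [:: x; y] => r' rr'.
  by exists y, a, z, b; rewrite !rr' ?inE ?eqxx ?orbT.
move=> r x [y1 [a [y2 [b [z [c [rx r1 r2 zc]]]]]]].
have [s sP] : exists s : seq X, forall r', {in s, r' =1 r} ->
    row_app r' (row_app r' [set` a] [set` c]) (row_app r' [set` b] [set` c]) z.
  have cst (l : seq X) : finite_support (fun=> [set` l]) by move=> ? ? ?; exists [::].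
  by move: r z zc {rx r1 r2}; do 2!apply: finite_support_app.
exists [:: x, y1, y2 & s] => r' rr'; exists y1, a, y2, b, z, c.
rewrite !rr' ?inE ?eqxx ?orbT //; split=> //; apply: sP => v vs.
by apply: rr'; rewrite !inE vs !orbT.
Qed.

End FiniteSupport.

(** * From finite tables to models and back *)

Lemma has_rowP p j T : has_row p j T <->
  exists2 i, i < size T & p (j + i) (nth [::] T i).
Proof.
elim: T j => [|e T IHT] j /=; first by split=> // -[].
split=> [/orP[pe|/IHT[i ltiT pi]]|[[|i] ltiT pi]].
- by exists 0; rewrite // addn0.
- by exists i.+1; rewrite // addnS.
- by move: pi; rewrite addn0 => ->.
- by apply/orP; right; apply/IHT; exists i => //; rewrite addSnnS.
Qed.

Lemma table_appE T (p q : nat -> bool) (d e : set nat) :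
  (forall y, p y <-> d y) -> (forall y, q y <-> e y) ->
  forall y, table_app T p q y <-> row_app (nth [::] T) d e y.
Proof.
move=> pd qe y; rewrite /table_app has_rowP; split.
  case=> i _; rewrite add0n; case E: (nth _ _ i) => [//|x a].
  case/and3P => /eqP <- /pd di /allP aq; exists i, a; split=> //.
  by move=> z /aq /qe.
case=> i [a [ri /pd di ae]]; exists i.
  by rewrite ltnNge; apply/negP => /(nth_default [::]) E; rewrite E in ri.
by rewrite add0n ri eqxx di; apply/allP => z /ae /qe.
Qed.

Lemma table_denE T t y : table_den T t y <-> row_den (nth [::] T) t y.
Proof.
elim: t y => [||t IHt u IHu] y /=; last exact: table_appE.
- rewrite /table_k; case Ey: (nth _ _ y) => [|x a].
    by split=> // -[x [a [z [b []]]]]; rewrite Ey.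
  case Ex: (nth _ _ x) => [|z b].
    by split=> // -[x' [a' [z' [b' []]]]]; rewrite Ey => -[<- _]; rewrite Ex.
  split=> [za|[x' [a' [z' [b' []]]]]]; first by exists x, a, z, b.
  by rewrite Ey => -[<- <-]; rewrite Ex => -[<- _].
rewrite /table_s; case Ey: (nth _ _ y) => [|y1 a].
  by split=> // -[? [? [? [? [? [? []]]]]]]; rewrite Ey.
case E1: (nth _ _ y1) => [|y2 b].
  by split=> // -[? [? [? [? [? [? []]]]]]]; rewrite Ey => -[<- _]; rewrite E1.
case E2: (nth _ _ y2) => [|z c].
  split=> // -[? [? [? [? [? [? []]]]]]]; rewrite Ey => -[<- _].
  by rewrite E1 => -[<- _]; rewrite E2.
have tabE : table_app T (table_app T [in a] [in c]) (table_app T [in b] [in c]) z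
    <-> row_app (nth [::] T) (row_app (nth [::] T) [set` a] [set` c])
          (row_app (nth [::] T) [set` b] [set` c]) z.
  by do 2!apply: table_appE.
split=> [/tabE|]; first by exists y1, a, y2, b, z, c.
case=> [? [? [? [? [? [? []]]]]]]; rewrite Ey => -[<- <-].
by rewrite E1 => -[<- <-]; rewrite E2 => -[<- <-] /tabE.
Qed.

(** From [N] on, positions serve to give a code to every pair, whatever [T] is. *)
Definition extend_table (T : seq (seq nat)) (N x : nat) : seq nat :=
  if x < N then nth [::] T x else CodeSeq.decode (x - N).

Lemma extend_table_surj T N y (a : seq nat) :
  exists x (b : seq nat), extend_table T N x = y :: b /\ b =i a.
Proof.
exists (N + CodeSeq.code (y :: a)), a; split=> //.
by rewrite /extend_table ltnNge leq_addr addKn CodeSeq.codeK.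
Qed.

(** The table is completed from a position [N] past [y], so that the row of [y],
    hence its membership in [CI], is that of the table even when this row is
    missing. *)
Lemma table_den_sub_id T t y :
  (forall A : calg, den A t = den A CI) -> table_den T t y -> table_id T y.
Proof.
move=> tI /table_denE ty.
pose N := maxn (size T) y.+1.
have : row_den (extend_table T N) t y.
  rewrite -[y]/(id y); apply: row_den_morph ty => x; rewrite map_id => rx.
  rewrite /extend_table leq_max; case: ltnP => //= /(nth_default [::]) E.
  by rewrite E in rx.
have surj := extend_table_surj T N.
rewrite -(row_calgE surj) tI row_calgE (row_den_id surj) => -[z [c]].
by rewrite /extend_table leq_max ltnSn orbT /table_id => -[->].
Qed.

(** The table lists the rows of the finitely many points [s] that a derivation of
    [row_den r t x] inspects, each point being named by its position. *)
Lemma table_of_row (X : eqType) (r : X -> seq X) t x : row_den r t x ->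
  ~ (exists z c, r x = z :: c /\ z \in c) ->
  exists T y, table_den T t y && ~~ table_id T y.
Proof.
move=> /row_den_support[s sP] nid.
(* Positions are faithful on [ys] only, all other points being named [size ys].
   The row of [x] is included because the identity test compares its items. *)
pose ys := undup (x :: s ++ r x).
pose T := [seq [seq index z ys | z <- r u] | u <- ys].
pose r' u := if u \in ys then r u else [::].
have r'x : row_den r' t x.
  apply: sP => u us; rewrite /r' mem_undup in_cons mem_cat us orbT //.
have nthT u : u \in ys -> nth [::] T (index u ys) = [seq index z ys | z <- r u].
  by move=> uys; rewrite (nth_map x) ?index_mem // nth_index.
exists T, (index x ys); apply/andP; split.
  apply/table_denE; apply: (row_den_morph (phi := index^~ ys)) r'x => u.
  by rewrite /r'; case: ifP => // uys _; rewrite nthT.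
have xys : x \in ys by rewrite mem_undup mem_head.
rewrite /table_id nthT //; case E: (r x) => [//|z c] /=.
apply/negP => /mapP[z' z'c eqz]; apply: nid; exists z, c; split=> //.
suff <- : z' = z by [].
have rys u : u \in r x -> u \in ys.
  by move=> ux; rewrite mem_undup in_cons mem_cat ux !orbT.
have zys : z \in ys by apply: rys; rewrite E mem_head.
have z'ys : z' \in ys by apply: rys; rewrite E in_cons z'c orbT.
by rewrite -(nth_index x zys) eqz nth_index.
Qed.

(** * Graph models *)

Section GraphModel.
Variable G : total_pair.
Local Notation X := {classic web G}.

Definition fin_enum (a : finsub G) : seq X :=
  sval (cid ((@finite_seqP X (sval a)).1 (svalP a))).

Lemma fin_enumE a : sval a = [set` fin_enum a].
Proof. by rewrite /fin_enum; case: cid. Qed.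

Definition fin_set (s : seq X) : finsub G := exist _ [set` s] (finite_seq s).

Definition graph_row (x : X) : seq X :=
  if pselect (exists p, x = @web_map G p) is left e then
    (sval (cid e)).2 :: fin_enum (sval (cid e)).1
  else [::].

Lemma graph_row_map a y : graph_row (web_map (a, y)) = y :: fin_enum a.
Proof.
rewrite /graph_row; case: pselect => [e|[]]; last by exists (a, y).
by case: cid => p /= /web_map_inj <-.
Qed.

Lemma graph_rowP x y s : graph_row x = y :: s ->
  exists a, x = web_map (a, y) /\ sval a = [set` s].
Proof.
rewrite /graph_row; case: pselect => // e; case: cid => -[a z] /= -> [<- <-].
by exists a; rewrite fin_enumE.
Qed.

Lemma graph_row_surj y (s : seq X) :
  exists x (b : seq X), graph_row x = y :: b /\ b =i s.
Proof.
exists (web_map (fin_set s, y)), (fin_enum (fin_set s)).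
split=> [|z]; first exact: graph_row_map.
have /seteqP[h1 h2] := fin_enumE (fin_set s).
by apply/idP/idP; [exact: h2 | exact: h1].
Qed.

Lemma interp_app rho M N : interp rho (App M N) =
  row_app graph_row (interp rho M : set X) (interp rho N).
Proof.
apply/seteqP; split=> y /=.
  case=> a [aN Ma]; exists (web_map (a, y)), (fin_enum a).
  by rewrite graph_row_map -fin_enumE.
by case=> x [s [/graph_rowP[a [-> <-]] Mx sN]]; exists a.
Qed.

Lemma interp_to_term rho t : interp rho (to_term t) = row_den graph_row t.
Proof.
elim: t rho => [||t IHt u IHu] rho; last by rewrite [LHS]interp_app IHt IHu.
- apply/seteqP; split=> x.
    case=> a [_ [[b [z [/= za ->]]] ->]].
    exists (web_map (b, z)), (fin_enum a), z, (fin_enum b).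
    rewrite !graph_row_map; split=> //.
    by move: za; rewrite /update /= fin_enumE.
  case=> y [s [z [s' [/graph_rowP[a [-> aE]] /graph_rowP[b [-> bE]] zs]]]].
  exists a, (web_map (b, z)); split=> //; exists b, z; split=> //=.
  by rewrite /update /= aE.
- have E a b c z :
      interp (update (update (update rho 0 (sval a)) 1 (sval b)) 2 (sval c))
        (App (App (Var 0) (Var 2)) (App (Var 1) (Var 2))) z <->
      row_app graph_row (row_app graph_row (sval a : set X) (sval c))
        (row_app graph_row (sval b : set X) (sval c)) z.
    by rewrite !interp_app.
  apply/seteqP; split=> x.
    case=> a [_ [[b [_ [[c [z [/E zE ->]]] ->]]] ->]].
    exists (web_map (b, web_map (c, z))), (fin_enum a), (web_map (c, z)), (fin_enum b).
    by exists z, (fin_enum c); rewrite !graph_row_map -!fin_enumE.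
  case=> y1 [s1 [y2 [s2 [z [s3 []]]]]].
  move=> /graph_rowP[a [-> aE]] /graph_rowP[b [-> bE]] /graph_rowP[c [-> cE]].
  rewrite -aE -bE -cE => /E zE.
  exists a, (web_map (b, web_map (c, z))); split=> //.
  by exists b, (web_map (c, z)); split=> //; exists c, z.
Qed.

Definition id_term := Lam 0 (Var 0).

Lemma interp_id rho : interp rho id_term =
  [set x : X | exists z c, graph_row x = z :: c /\ z \in c].
Proof.
apply/seteqP; split=> x.
  case=> a [z [/= za ->]]; exists z, (fin_enum a); rewrite graph_row_map.
  by split=> //; move: za; rewrite /update /= fin_enumE.
case=> z [s [/graph_rowP[a [-> aE]] zs]]; exists a, z; split=> //=.
by rewrite /update /= aE.
Qed.

(** The point [i({y}, i(b, y))] lies in [K], and in [I] only if [i(b, y) = y]; this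
    cannot hold for both [b = {}] and [b = {y}]. *)
Lemma k_not_sub_id : ~ order_theory G (to_term CK, id_term).
Proof.
move=> KI.
have [y _] : exists y : web G, True.
  apply: contrapT => noG; apply: (@web_infinite G).
  suff -> : [set: web G] = set0 by exact: finite_set0.
  by apply/seteqP; split=> // y _; apply: noG; exists y.
have wE b : web_map (b, y) = y.
  have : interp (fun=> set0) (to_term CK) (web_map (fin_set [:: y : X], web_map (b, y))).
    exists (fin_set [:: y : X]), (web_map (b, y)); split=> //.
    by exists b, y; split=> //; rewrite /= /update /= inE.
  move=> /KI[a [z [/= za /web_map_inj[eqa eqz]]]].
  by move: za; rewrite /update /= -eqa -eqz /= inE => /eqP.
have := wE (fin_set [:: y : X]); rewrite -[in RHS](wE (fin_set [::])).
move/web_map_inj/(congr1 (fun p => sval p.1 y)) => yE.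
have y1 : sval (fin_set [:: y : X]) y by rewrite /= mem_head.
by have : sval (fin_set [::]) y by rewrite -yE.
Qed.

End GraphModel.

Lemma godel2_inj : injective godel2.
Proof.
move=> [P Q] [P' Q'] /(can_inj CodeSeq.codeK).
by rewrite /= => -[/godel_inj -> /godel_inj ->].
Qed.

Theorem theorem4 (G : total_pair) : ~ re_pairs (order_theory G).
Proof.
case=> f fE.
have [M] := diagonal_term f (godel id_term).
set m := CodeSeq.code _; have mE : m = godel2 (to_term M, id_term) by [].
have fG : (exists y, reval f [tuple m] y) <-> order_theory G (to_term M, id_term).
  rewrite -fE mE; split=> [[p pG /godel2_inj <-] //|pG].
  by exists (to_term M, id_term).
case=> [[[w /accepted_sound/fG MI] MK]|[[w wM] MI]|none].
- apply: (@k_not_sub_id G) => rho; have := MI rho.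
  by rewrite !interp_to_term -!(row_calgE (@graph_row_surj G)) MK.
- case/andP: wM => /(table_den_sub_id MI) Mid.
  by rewrite Mid.
have : order_theory G (to_term M, id_term).
  move=> rho; rewrite [interp _ _]interp_to_term [X in _ `<=` X]interp_id => x Mx.
  apply: contrapT.
  move=> /(table_of_row Mx)[T [y /exceeds_id_complete[w wM]]].
  by have := none w; rewrite wM andbF.
case/fG => y /accepted_complete[w acc_w].
by have := none w; rewrite acc_w.
Qed.
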